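(* Let $X$ be a finite alphabet with $|X|=N$, symbols of types GEN, PROP, KILL with counts $g,t,k$, $g\ge1$; let $x_1,x_2,\dots$ be i.i.d. uniform on $X$, $\sigma_0=0$, $\sigma_j=T_{x_j}(\sigma_{j-1})$, $\nu_L=\sum_{j=1}^L\sigma_j$, and $D_{\mathrm{trans}}(L)=\mathrm{Var}(\nu_L)/\mathrm E[\nu_L]$. With $\mu=t/N$, $\pi_0=k/(g+k)$ and $D_\infty=\pi_0(1+\mu)/(1-\mu)$ (the limiting dispersion index of the stationary chain), we have \[D_{\mathrm{trans}}(L)=D_\infty+O(1/L)\quad(L\to\infty).\]
   Context: GEN symbols act on the state space $\{0,1\}$ as the constant map $1$, PROP as the identity, KILL as the constant map $0$; $T_x$ is the action of $x$. *)

(* Defs.v *)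
From HB Require Import structures.
From mathcomp Require Import all_boot all_order all_algebra.
From mathcomp Require Import all_classical all_reals all_analysis.

Set Implicit Arguments.
Unset Strict Implicit.
Unset Printing Implicit Defensive.

Import Order.TTheory GRing.Theory Num.Theory.
Import numFieldNormedType.Exports.

Local Open Scope classical_set_scope.
Local Open Scope ring_scope.

Inductive symbol_type := GEN | PROP | KILL.

Definition symbol_type_eqb (a b : symbol_type) : bool :=
  match a, b with
  | GEN, GEN | PROP, PROP | KILL, KILL => true
  | _, _ => false
  end.

Lemma symbol_type_eqP : Equality.axiom symbol_type_eqb.
Proof. by case=> [] []; constructor. Qed.

HB.instance Definition _ := hasDecEq.Build symbol_type symbol_type_eqP.

(* The state space {0,1} is [bool], coerced to [nat] when states are summed. *)
Definition action (c : symbol_type) (s : bool) : bool :=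
  match c with
  | GEN => true
  | PROP => s
  | KILL => false
  end.

Section IID.
Context {d : measure_display} {T : measurableType d} {R : realType}.
Variables (P : probability T R) (X : finType) (x : nat -> T -> X).

(* [X] carries the discrete sigma-algebra. *)
Definition random_letters :=
  forall (j : nat) (A : set X), measurable (x j @^-1` A).

Definition mutually_independent :=
  forall (J : seq nat) (A : nat -> set X), uniq J ->
    P (\bigcap_(j in [set` J]) (x j @^-1` A j))
    = (\prod_(j <- J) P (x j @^-1` A j))%E.

Definition uniform_letters :=
  forall (j : nat) (a : X), P (x j @^-1` [set a]) = (#|X|%:R^-1)%:E.

Definition iid_uniform :=
  [/\ random_letters, mutually_independent & uniform_letters].

End IID.

Section Chain.
Context {d : measure_display} {T : measurableType d} {R : realType}.
Variables (P : probability T R) (X : finType) (ty : X -> symbol_type).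
(* [x j] is the letter $x_{j+1}$: the input sequence $x_1, x_2, \dots$ is
   indexed from 0. *)
Variable x : nat -> T -> X.

Fixpoint sigma (j : nat) (w : T) : bool :=
  if j is i.+1 then action (ty (x i w)) (sigma i w) else false.

Definition nu (L : nat) (w : T) : R :=
  (\sum_(1 <= j < L.+1) sigma j w)%N%:R.

(* [nu L] is bounded, so its expectation and variance are finite and [fine]
   loses nothing. *)
Definition Dtrans (L : nat) : R := fine 'V_P[nu L] / fine 'E_P[nu L].

End Chain.

(* Main.v *)
(* Write p, mu for the frequencies of GEN and PROP, s_L, A_L, V_L for
   E[sigma_L], E[nu_L], Var(nu_L), and W_L for Cov(nu_L, sigma_L). Since the
   next letter is independent of the past,
     V_(L+1) = V_L + 2 mu W_L + s_(L+1) (1 - s_(L+1)),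
     W_(L+1) = mu W_L + s_(L+1) (1 - s_(L+1)),
   so W is bounded, and V + 2 mu W / (1 - mu) - Dinf A has increments of order
   mu^L, hence is bounded too. As A_L >= p L with p > 0, dividing
   V_L - Dinf A_L = O(1) by A_L gives the rate 1/L. *)

Require Import Defs.
From HB Require Import structures.
From mathcomp Require Import all_boot all_order all_algebra.
From mathcomp Require Import all_classical all_reals all_analysis.
From mathcomp Require Import ring lra.

Import Order.TTheory GRing.Theory Num.Theory.
Import numFieldNormedType.Exports.

Local Open Scope classical_set_scope.
Local Open Scope ring_scope.

(** * Uniform averages over words *)

Section UniformWords.
Context {R : realType} {X : finType}.

Fixpoint words (L : nat) : seq (seq X) :=
  if L is l.+1 then [seq a :: s | a <- enum X, s <- words l] else [:: [::]].

Lemma mem_words (L : nat) (s : seq X) : (s \in words L) = (size s == L).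
Proof.
elim: L s => [|L IH] [|a s] //=; first by apply/allpairsP => -[[]] /= ? ? [].
rewrite eqSS -IH; apply/allpairsP/idP => [[[b r]] /= [_ hr [_ ->]] //|hs].
by exists (a, s); rewrite mem_enum.
Qed.

Lemma uniq_words (L : nat) : uniq (words L).
Proof.
elim: L => //= L IH; apply: allpairs_uniq => //; first exact: enum_uniq.
by move=> [a s] [b r] _ _ /= [-> ->].
Qed.

Definition word_mean (L : nat) (f : seq X -> R) : R :=
  #|X|%:R^-1 ^+ L * \sum_(s <- words L) f s.

Lemma word_mean0 (f : seq X -> R) : word_mean 0 f = f [::].
Proof. by rewrite /word_mean expr0 mul1r big_seq1. Qed.

(** The head of a word is the most recent letter and is independent of the tail. Averaging over it
    is how every moment recursion below passes from [L] to [L.+1]. *)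
Lemma word_meanS (L : nat) (f : seq X -> R) :
  word_mean L.+1 f = #|X|%:R^-1 * \sum_(a : X) word_mean L (f \o cons a).
Proof.
rewrite /word_mean /= big_allpairs_dep /= exprS -mulrA -mulr_sumr.
by rewrite big_enum.
Qed.

Lemma eq_word_mean (L : nat) (f h : seq X -> R) :
  f =1 h -> word_mean L f = word_mean L h.
Proof. by move=> e; rewrite /word_mean; under eq_bigr do rewrite e. Qed.

Lemma word_meanD (L : nat) (f h : seq X -> R) :
  word_mean L (fun s => f s + h s) = word_mean L f + word_mean L h.
Proof. by rewrite /word_mean big_split mulrDr. Qed.

Lemma word_meanZ (L : nat) (c : R) (f : seq X -> R) :
  word_mean L (fun s => c * f s) = c * word_mean L f.
Proof. by rewrite /word_mean -mulr_sumr mulrCA. Qed.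

Lemma word_mean_cst (L : nat) (c : R) :
  (0 < #|X|)%N -> word_mean L (fun=> c) = c.
Proof.
move=> X0; elim: L => [|L IH]; first by rewrite word_mean0.
rewrite word_meanS /comp; under eq_bigr do rewrite IH.
rewrite sumr_const -[c *+ _]mulr_natl mulrA mulVf ?mul1r //.
by rewrite pnatr_eq0 -lt0n.
Qed.

End UniformWords.

(** * The law of the letters read so far *)

Section History.
Context {d : measure_display} {T : measurableType d} {R : realType}.
Context (P : probability T R) {X : finType} (x : nat -> T -> X).

(* The letters read so far, most recent first. *)
Fixpoint history (L : nat) (w : T) : seq X :=
  if L is l.+1 then x l w :: history l w else [::].

Lemma size_history (L : nat) (w : T) : size (history L w) = L.
Proof. by elim: L => //= L ->. Qed.

Lemma measurable_history (L : nat) (s : seq X) :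
  random_letters x -> measurable [set w | history L w = s].
Proof.
move=> mx; elim: L s => [|L IH] [|a s] /=.
- by rewrite (_ : mkset _ = setT)//; apply/seteqP; split.
- by rewrite (_ : mkset _ = set0)//; apply/seteqP; split.
- by rewrite (_ : mkset _ = set0)//; apply/seteqP; split.
rewrite (_ : mkset _ = x L @^-1` [set a] `&` [set w | history L w = s]).
  exact: measurableI.
by apply/seteqP; split => w /= [-> ->].
Qed.

(** Turns the event of reading [s] into a cylinder, the form to which mutual independence applies;
    [a0] only fills the positions from [L] on. *)
Lemma history_letters (a0 : X) (L : nat) (s : seq X) : size s = L ->
  exists b : nat -> X,
    forall w, history L w = s <-> forall j, (j < L)%N -> x j w = b j.
Proof.
elim: L s => [|L IH] [|a s] //=; first by exists (fun=> a0).
move=> [] /IH[b bP]; exists (fun j => if j == L then a else b j) => w; split.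
  move=> [xa /bP xb] j; rewrite ltnS leq_eqVlt.
  by case: eqP => [->|_ /= /xb].
move=> xb; have := xb L (ltnSn L); rewrite eqxx => ->; congr (_ :: _).
by apply/bP => j jL; rewrite xb ?(ltn_eqF jL) // ltnS ltnW.
Qed.

Hypothesis hx : iid_uniform P x.

Lemma probability_history (L : nat) (s : seq X) : size s = L ->
  P [set w | history L w = s] = (#|X|%:R^-1 ^+ L)%:E.
Proof.
(* The default letter is taken from [s], so the empty word, whose event is the whole space, is split
   off. *)
case: hx => _ ind unif; case: L => [|L] sL.
  rewrite (size0nil sL) (_ : mkset _ = setT) ?probability_setT //.
  by apply/seteqP; split.
have [a0 _] : exists a : X, true by case: s sL => // a; exists a.
have [b bP] := history_letters a0 _ _ sL.
have := ind (iota 0 L.+1) (fun j => [set b j]) (iota_uniq _ _).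
rewrite (_ : \bigcap_(_ in _) _ = [set w | history L.+1 w = s]).
  move=> ->; under eq_bigr do rewrite unif.
  rewrite prodEFin; congr EFin.
  by rewrite big_const_seq count_predT size_iota iter_mulr_1.
have J j : [set` iota 0 L.+1] j <-> (j < L.+1)%N.
  by rewrite -[X in _ <-> is_true X](mem_iota 0).
apply/seteqP; split => w; first by move=> h; apply/bP => j /J; exact: h.
by move=> /bP h j /J; exact: h.
Qed.

Lemma expectation_history (L : nat) (f : seq X -> R) :
  ('E_P[fun w => f (history L w)] = (word_mean L f)%:E)%E.
Proof.
have [mx _ _] := hx.
pose D s := [set w | history L w = s].
have mD s : measurable (D s) by exact: measurable_history.
(* The integrand is a simple function: among the indicators summed over all words, only that of the
   word actually read is nonzero at [w]. *)
rewrite unlock (eq_integral (fun w =>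
    \sum_(s <- words L) ((f s)%:E * (\1_(D s) w)%:E))%E); last first.
  move=> w _; rewrite (bigD1_seq (history L w)) ?uniq_words //=; last first.
    by rewrite mem_words size_history.
  rewrite big1 ?adde0 => [|s /negP sw].
    by rewrite indicE mem_set // mule1.
  by rewrite indicE memNset ?mule0 // => /= e; apply: sw; rewrite e.
rewrite integral_sum //; last first.
  by move=> s; apply: integrableZl => //; exact: integrable_indic.
rewrite /word_mean mulr_sumr -sumEFin big_seq [RHS]big_seq.
apply: eq_bigr => s; rewrite mem_words => /eqP sL.
rewrite integralZl //; last exact: integrable_indic.
rewrite integral_indic // setIT mulrC EFinM.
by congr (_ * _)%E; exact: probability_history.
Qed.

End History.

(** * Moments of the chain *)

Section Moments.
Context {R : realType} {X : finType}.
Variable ty : X -> symbol_type.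

Fixpoint final_state (s : seq X) : bool :=
  if s is a :: s' then action (ty a) (final_state s') else false.

(** Each suffix of a history is an earlier history, so its final state is an earlier state of the
    chain. *)
Fixpoint visits (s : seq X) : R :=
  if s is a :: s' then (final_state s)%:R + visits s' else 0.

Definition freq (c : symbol_type) : R :=
  #|[set a | ty a == c]%SET|%:R / #|X|%:R.

Lemma sum_symbol_type (F : symbol_type -> R) :
  #|X|%:R^-1 * \sum_(a : X) F (ty a) =
  freq GEN * F GEN + freq PROP * F PROP + freq KILL * F KILL.
Proof.
have E a : F (ty a) = (ty a == GEN)%:R * F GEN + (ty a == PROP)%:R * F PROP
    + (ty a == KILL)%:R * F KILL.
  by case: (ty a); rewrite /= ?eqxx ?mul1r ?mul0r ?addr0 ?add0r.
under eq_bigr do rewrite E.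
rewrite !big_split /= -!mulr_suml -!natr_sum.
have C c : (\sum_(a : X) (ty a == c) = #|[set a | ty a == c]%SET|)%N.
  by rewrite -sum1dep_card [RHS]big_mkcond; apply: eq_bigr => a _; case: eqP.
by rewrite !C /freq; ring.
Qed.

(** The head letter acts only through its type, so conditioning on it leaves three cases weighted by
    the type frequencies. *)
Lemma word_mean_type (L : nat) (f : seq X -> R)
    (h : symbol_type -> seq X -> R) :
  (forall a s, f (a :: s) = h (ty a) s) ->
  word_mean L.+1 f = freq GEN * word_mean L (h GEN)
    + freq PROP * word_mean L (h PROP) + freq KILL * word_mean L (h KILL).
Proof.
move=> fh; rewrite word_meanS -(sum_symbol_type (fun c => word_mean L (h c))).
by congr (_ * _); apply: eq_bigr => a _; apply: eq_word_mean => s /=.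
Qed.

Hypothesis X_gt0 : (0 < #|X|)%N.

Lemma freq_KILL : freq KILL = 1 - freq GEN - freq PROP.
Proof.
have := sum_symbol_type (fun=> 1); rewrite !mulr1.
rewrite sumr_const mulVf ?pnatr_eq0 -?lt0n // => ->; ring.
Qed.

Definition mean_state L := word_mean L (fun s => (final_state s)%:R : R).
Definition mean_visits L := word_mean L visits.
Definition mean_visits_state L :=
  word_mean L (fun s => visits s * (final_state s)%:R).
Definition mean_visits2 L := word_mean L (fun s => visits s ^+ 2).

Lemma mean_stateS (L : nat) :
  mean_state L.+1 = freq GEN + freq PROP * mean_state L.
Proof.
rewrite /mean_state
  (word_mean_type _ _ (fun c s => (action c (final_state s))%:R)) //=.
by rewrite !word_mean_cst // mulr1 mulr0 addr0.
Qed.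

Lemma mean_visitsS (L : nat) :
  mean_visits L.+1 = mean_visits L + mean_state L.+1.
Proof.
rewrite mean_stateS /mean_visits /mean_state
  (word_mean_type _ _ (fun c s => (action c (final_state s))%:R + visits s)) //=.
by rewrite !word_meanD !word_mean_cst // freq_KILL; ring.
Qed.

(** With [b] the new state and [v] the old visits, [b ^+ 2 = b] gives [(b + v) * b = b + v * b]. In
    the last product GEN leaves [v], PROP keeps the old state as factor, and KILL gives 0. *)
Lemma mean_visits_stateS (L : nat) :
  mean_visits_state L.+1 = freq GEN * mean_visits L
    + freq PROP * mean_visits_state L + mean_state L.+1.
Proof.
rewrite mean_stateS /mean_visits /mean_state /mean_visits_state
  (word_mean_type _ _ (fun c s => let b := (action c (final_state s))%:R in
    b + visits s * b)) => [|a s /=]; last by case: action => /=; ring.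
rewrite !word_meanD !word_mean_cst //.
rewrite (eq_word_mean _ (fun s => visits s * _) visits) => [|s]; last exact: mulr1.
rewrite (eq_word_mean _ (fun s => visits s * (action KILL _)%:R) (fun=> 0)) => [|s].
  by rewrite !word_mean_cst // freq_KILL; ring.
exact: mulr0.
Qed.

(** Again by [b ^+ 2 = b], [(b + v) ^+ 2 = b + 2 * (v * b) + v ^+ 2], and [v * b] is the new product
    of visits and state minus [b]. *)
Lemma mean_visits2S (L : nat) :
  mean_visits2 L.+1 =
  mean_visits2 L + 2 * mean_visits_state L.+1 - mean_state L.+1.
Proof.
rewrite mean_visits_stateS mean_stateS /mean_visits /mean_state
  /mean_visits_state /mean_visits2
  (word_mean_type _ _ (fun c s => let b := (action c (final_state s))%:R in
    b + 2 * (visits s * b) + visits s ^+ 2)) => [|a s /=]; last first.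
  by case: action => /=; ring.
rewrite !word_meanD !word_meanZ !word_mean_cst //.
rewrite (eq_word_mean _ (fun s => visits s * _) visits) => [|s]; last exact: mulr1.
rewrite (eq_word_mean _ (fun s => visits s * (action KILL _)%:R) (fun=> 0)) => [|s].
  by rewrite !word_mean_cst // freq_KILL; ring.
exact: mulr0.
Qed.

End Moments.

(** * Bounds on the moments *)

(* [s], [A], [B], [C] stand for the expectations of sigma_L, nu_L,
   nu_L sigma_L and nu_L^2, and [p], [m] for the frequencies of GEN and PROP. *)
Section MomentRecursion.
Context {R : realType} (p m : R) (s A B C : nat -> R).
Hypotheses (p_gt0 : 0 < p) (m_ge0 : 0 <= m) (pm_le1 : p + m <= 1).
Hypotheses (s0 : s 0 = 0) (A0 : A 0 = 0) (B0 : B 0 = 0) (C0 : C 0 = 0).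
Hypotheses (sS : forall L, s L.+1 = p + m * s L)
  (AS : forall L, A L.+1 = A L + s L.+1)
  (BS : forall L, B L.+1 = p * A L + m * B L + s L.+1)
  (CS : forall L, C L.+1 = C L + 2 * B L.+1 - s L.+1).

Let r : R := (1 - m)^-1.
Let cov L := B L - A L * s L.
Let var L := C L - A L ^+ 2.
(** Here [(1 - p - m) * r] is pi_0: the frequency of KILL divided by that of GEN and KILL
    together. *)
Let Dinf := (1 - p - m) * r * (1 + m) * r.
Let excess L := var L + 2 * m * r * cov L - Dinf * A L.

Let rE : r * (1 - m) = 1. Proof. by rewrite mulVf // gt_eqF //; move: p_gt0 m_ge0 pm_le1; lra. Qed.
Let r_gt0 : 0 < r. Proof. by rewrite invr_gt0; move: p_gt0 m_ge0 pm_le1; lra. Qed.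
Let r_ge0 : 0 <= r := ltW r_gt0.
Let p_ge0 : 0 <= p := ltW p_gt0.

(** The affine recursion has fixed point [p * r], the stationary probability of state 1, and
    contracts towards it by the factor [m]. *)
Lemma moment_sE (L : nat) : s L = p * r * (1 - m ^+ L).
Proof.
elim: L => [|L IH]; first by rewrite s0 expr0 subrr mulr0.
rewrite sS IH exprS; have : p = p * (r * (1 - m)) by rewrite rE mulr1.
by move=> e; rewrite {1}e; ring.
Qed.

Let pr_le1 : p * r <= 1.
Proof. by rewrite ler_pdivrMr; move: p_gt0 m_ge0 pm_le1; lra. Qed.

Let pow01 (L : nat) : 0 <= m ^+ L <= 1.
Proof. by rewrite exprn_ge0 // exprn_ile1 //; move: p_gt0 m_ge0 pm_le1; lra. Qed.

Lemma moment_s_bounds (L : nat) : 0 <= s L <= 1.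
Proof.
rewrite moment_sE; have /andP[u0 u1] := pow01 L.
have pr0 : 0 <= p * r by rewrite mulr_ge0 ?p_ge0 ?r_ge0.
have v0 : 0 <= 1 - m ^+ L by lra.
have v1 : 1 - m ^+ L <= 1 by lra.
by rewrite mulr_ge0 //= mulr_ile1.
Qed.

(** A GEN letter forces state 1 whatever the past, so every step adds at least [p]. *)
Lemma moment_A_ge (L : nat) : p * L%:R <= A L.
Proof.
elim: L => [|L IH]; first by rewrite mulr0 A0.
rewrite AS sS -natr1 mulrDr mulr1 lerD // lerDl mulr_ge0 //.
by case/andP: (moment_s_bounds L).
Qed.

Lemma covS (L : nat) : cov L.+1 = m * cov L + s L.+1 * (1 - s L.+1).
Proof. by rewrite /cov BS AS sS; ring. Qed.

(** The map sending c to [m * c + 1] has fixed point [r], so it preserves the upper bound; the added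
    variance of the state is at most 1. *)
Lemma cov_bounds (L : nat) : 0 <= cov L <= r.
Proof.
elim: L => [|L /andP[c0 c1]].
  by rewrite /cov B0 A0 mul0r subrr lexx r_ge0.
have /andP[u0 u1] := moment_s_bounds L.+1.
have v0 : 0 <= s L.+1 * (1 - s L.+1) by rewrite mulr_ge0 ?subr_ge0.
rewrite covS (addr_ge0 (mulr_ge0 m_ge0 c0) v0) /=.
have : m * cov L <= m * r by rewrite ler_wpM2l.
have : s L.+1 * (1 - s L.+1) <= 1 by rewrite mulr_ile1 ?subr_ge0 // lerBlDl lerDr.
by move: rE; lra.
Qed.

(* Adding the multiple of [cov] cancels the linear growth, leaving increments
   that decay like [m ^+ L]. *)
Lemma excessS (L : nat) : excess L.+1 =
  excess L + (1 + m) * r * (p * r * m ^+ L.+1 * s L.+1).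
Proof.
have vS : var L.+1 = var L + 2 * m * cov L + s L.+1 * (1 - s L.+1).
  by rewrite /var /cov CS BS AS sS; ring.
(* With [s] taken at [L.+1], the increment is [(1 + m) * r * s * (p * r - s)]. [e1] gives its last
   factor, while [e2] and [e4] extract the common factor [(1 + m) * r]. *)
have e1 : p * r * m ^+ L.+1 = p * r - s L.+1 by rewrite moment_sE; ring.
have e2 : Dinf = (1 + m) * r * (1 - p * r).
  have -> : 1 - p * r = r * (1 - m) - p * r by rewrite rE.
  by rewrite /Dinf; ring.
(* In this form the old covariance terms recombine into [2 * m * r * cov L]. *)
have e3 : 2 * m * cov L = 2 * m * cov L * (r * (1 - m)) by rewrite rE mulr1.
have e4 : 1 + 2 * m * r = (1 + m) * r.
  by transitivity (r * (1 - m) + 2 * m * r); [rewrite rE | ring].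
rewrite /excess vS covS AS e1 e2 e3.
transitivity (var L + 2 * m * r * cov L - (1 + m) * r * (1 - p * r) * A L
  + s L.+1 * (1 - s L.+1) * (1 + 2 * m * r)
  - (1 + m) * r * (1 - p * r) * s L.+1); first by ring.
by rewrite e4; ring.
Qed.

(** The increments are at most [(1 + m) * r * m ^+ L], and the partial sums of this geometric series
    are exactly the upper bound. *)
Lemma excess_bounds (L : nat) : 0 <= excess L <= (1 + m) * r ^+ 2 * (1 - m ^+ L).
Proof.
elim: L => [|L /andP[c0 c1]].
  by rewrite /excess /var /cov B0 A0 C0 !(mul0r, mulr0, subrr, expr0, expr0n, addr0) lexx.
have /andP[u0 u1] := moment_s_bounds L.+1.
have /andP[v0 _] := pow01 L.
have m1 : m <= 1 by move: p_gt0 m_ge0 pm_le1; lra.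
rewrite excessS; set i := p * r * _ * _.
have i0 : 0 <= i by rewrite !mulr_ge0 ?exprn_ge0 ?p_ge0 ?r_ge0.
have i1 : i <= m ^+ L.
  rewrite /i -[leRHS]mulr1 ler_pM ?mulr_ge0 ?exprn_ge0 ?p_ge0 ?r_ge0 //.
  rewrite -[leRHS]mul1r ler_pM ?mulr_ge0 ?exprn_ge0 ?p_ge0 ?r_ge0 //.
  by rewrite exprS ler_piMl.
have f0 : 0 <= (1 + m) * r by rewrite mulr_ge0 ?r_ge0 //; move: p_gt0 m_ge0 pm_le1; lra.
rewrite (addr_ge0 c0 (mulr_ge0 f0 i0)) /=.
apply: le_trans (lerD c1 (ler_wpM2l f0 i1)) _.
have e : (1 + m) * r = (1 + m) * r * (r * (1 - m)) by rewrite rE mulr1.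
by rewrite le_eqVlt; apply/predU1P; left; rewrite e [m ^+ L.+1]exprS; ring.
Qed.

(** The excess and the covariance correction both lie between 0 and [2 * r ^+ 2], which gives the
    numerator; the factor [p] comes from the linear lower bound on [A]. *)
Lemma dispersion_bound (L : nat) : (0 < L)%N ->
  `|var L / A L - Dinf| <= (4 * r ^+ 2 / p) * L%:R^-1.
Proof.
move=> L0; have LR : 0 < L%:R :> R by rewrite ltr0n.
have ge := moment_A_ge L.
have A_gt0 : 0 < A L by apply: lt_le_trans ge; rewrite mulr_gt0.
have -> : var L / A L - Dinf = (excess L - 2 * m * r * cov L) / A L.
  by rewrite /excess; field; rewrite gt_eqF.
rewrite normrM normfV (gtr0_norm A_gt0) -[leRHS]mulrA -invfM.
apply: ler_pM; rewrite ?invr_ge0 ?(ltW A_gt0) //; last first.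
  by rewrite lef_pV2 // posrE mulr_gt0.
have /andP[c0 c1] := cov_bounds L.
have /andP[e0 e1] := excess_bounds L.
have /andP[v0 v1] := pow01 L.
have h1 : excess L <= 2 * r ^+ 2.
  apply: le_trans e1 _; rewrite mulrAC ler_wpM2r ?exprn_ge0 ?r_ge0 //.
  by rewrite -[leRHS]mulr1 ler_pM //; move: p_gt0 m_ge0 pm_le1; lra.
have h2 : 2 * m * r * cov L <= 2 * r ^+ 2.
  rewrite expr2 mulrA ler_pM ?mulr_ge0 ?r_ge0 //.
  by rewrite ler_wpM2r ?r_ge0 //; move: p_gt0 m_ge0 pm_le1; lra.
have h3 : 0 <= 2 * m * r * cov L by rewrite !mulr_ge0 ?r_ge0.
by rewrite ler_norml; move: p_gt0 m_ge0 pm_le1; lra.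
Qed.

End MomentRecursion.

(** * Transfer from words to the chain, and the limit *)

Lemma sigma_history {d : measure_display} {T : measurableType d} {X : finType}
    (ty : X -> symbol_type) (x : nat -> T -> X) (L : nat) (w : T) :
  sigma ty x L w = final_state ty (history x L w).
Proof. by elim: L => //= L ->. Qed.

Lemma nu_history {d : measure_display} {T : measurableType d} {R : realType}
    {X : finType} (ty : X -> symbol_type) (x : nat -> T -> X) (L : nat) (w : T) :
  nu ty x L w = visits ty (history x L w) :> R.
Proof.
elim: L => [|L IH]; first by rewrite /nu big_geq.
by rewrite /nu big_nat_recr //= natrD -/(nu ty x L w) IH addrC sigma_history.
Qed.

(** The mean and the variance are both expectations of functions of the history, hence finite word
    averages; expanding the centred square gives the second moment minus the squared mean. *)
Lemma DtransE {d : measure_display} {T : measurableType d} {R : realType}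
    (P : probability T R) {X : finType} (ty : X -> symbol_type)
    (x : nat -> T -> X) (L : nat) :
  (0 < #|X|)%N -> iid_uniform P x ->
  Dtrans P ty x L =
  (mean_visits2 ty L - mean_visits ty L ^+ 2) / mean_visits ty L.
Proof.
move=> X0 hx; rewrite /Dtrans /variance covariance.unlock.
have nuE : nu ty x L = (fun w => visits ty (history x L w)) :> (T -> R).
  by apply/funext => w; rewrite nu_history.
have EE : 'E_P[nu ty x L]%E = (mean_visits ty L)%:E.
  by rewrite nuE expectation_history.
rewrite EE /=; congr (_ / _); set A := mean_visits ty L.
rewrite [X in 'E_P[X]%E](_ : _ =
    (fun w => (visits ty (history x L w) - A) ^+ 2)); last first.
  by apply/funext => w; rewrite /= nuE expr2.
rewrite (expectation_history _ _ hx L (fun s => (visits ty s - A) ^+ 2)) /=.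
rewrite (@eq_word_mean _ _ L _ (fun s => visits ty s ^+ 2
    + ((- 2 * A) * visits ty s + A ^+ 2))) => [|s]; last by ring.
rewrite !word_meanD word_meanZ word_mean_cst //.
rewrite -/(mean_visits2 ty L) -/(mean_visits ty L) -/A; ring.
Qed.

Theorem theorem6p7 (R : realType) (d : measure_display) (T : measurableType d)
    (P : probability T R) (X : finType) (ty : X -> symbol_type)
    (x : nat -> T -> X) (N g t k : nat)
    (hN : #|X| = N)
    (hg : #|[set a | ty a == GEN]%SET| = g)
    (ht : #|[set a | ty a == PROP]%SET| = t)
    (hk : #|[set a | ty a == KILL]%SET| = k)
    (g_ge1 : (1 <= g)%N)
    (hx : iid_uniform P x) :
  let mu : R := t%:R / N%:R in
  let pi0 : R := k%:R / (g + k)%:R in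
  let Dinf : R := pi0 * (1 + mu) / (1 - mu) in
  (Dtrans P ty x : nat -> R^o) = cst Dinf +O_\oo (fun L : nat => L%:R^-1 : R^o).
Proof.
move=> mu pi0 Dinf.
have X0 : (0 < #|X|)%N.
  by apply: leq_trans g_ge1 _; rewrite -hg max_card.
have N0 : 0 < N%:R :> R by rewrite ltr0n -hN.
have g0 : 0 < g%:R :> R by rewrite ltr0n.
have k0 : 0 <= k%:R :> R by [].
set p : R := g%:R / N%:R.
have fG : freq ty GEN = p by rewrite /freq hg hN.
have fP : freq ty PROP = mu by rewrite /freq ht hN.
have fK : k%:R / N%:R = 1 - p - mu.
  by rewrite -fG -fP -freq_KILL // /freq hk hN.
have p0 : 0 < p by rewrite divr_gt0.
have mu0 : 0 <= mu by rewrite divr_ge0.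
have pm1 : p + mu <= 1.
  have : 0 <= k%:R / N%:R :> R by rewrite divr_ge0.
  by rewrite fK; lra.
have DE : Dinf = (1 - p - mu) * (1 - mu)^-1 * (1 + mu) * (1 - mu)^-1.
  rewrite /Dinf; congr (_ * _ * _); rewrite /pi0 -fK natrD.
  (* The three type frequencies sum to 1, so both occurrences of [1 - mu] match the denominator of
     pi_0. *)
  have -> : 1 - mu = (g%:R + k%:R) / N%:R.
    by rewrite mulrDl fK -/p; ring.
  by field; rewrite !gt_eqF //; lra.
pose c : R := 4 * (1 - mu)^-1 ^+ 2 / p.
apply/eqaddOP; near=> K; near=> L.
(* At [L = 0] the inverse takes its default value 0, so the bound is only claimed for positive
   [L]. *)
have L0 : (0 < L)%N by near: L; exact: nbhs_infty_gt.
rewrite /= fctE DtransE // DE.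
rewrite [`|L%:R^-1|]ger0_norm ?invr_ge0 //.
apply: (@le_trans _ _ (c * L%:R^-1)); last first.
  by rewrite ler_wpM2r ?invr_ge0 //; near: K; exact: nbhs_pinfty_ge.
apply: (dispersion_bound p mu (mean_state ty) (mean_visits ty)
  (mean_visits_state ty) (mean_visits2 ty)) => //.
- exact: word_mean0.
- exact: word_mean0.
- by rewrite /mean_visits_state word_mean0 mulr0.
- by rewrite /mean_visits2 word_mean0 expr0n.
- by move=> l; rewrite mean_stateS // fG fP.
- by move=> l; rewrite mean_visitsS.
- by move=> l; rewrite mean_visits_stateS // fG fP.
- by move=> l; rewrite mean_visits2S.
Unshelve. all: by end_near.
Qed.
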